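(* Let $\mathcal{C}$ be a minimum-transversal-covered clutter on a finite set $E$ which satisfies the integral blocking condition and $\mathcal{C}=\tilde{\mathcal{C}}$. Then the following are equivalent: (i) $\mathrm{I}(\mathcal{C})$ is an integral simplex and $\mathcal{C}$ is hyperedge-nonseparable; (ii) $\mathcal{C}$ satisfies the dimension condition and, for each $H\in\mathcal{C}$, there exists a facet transversal $B\in\mathrm{b}(\mathcal{C})$ of $H$.
   Context: A clutter on $E$ is a family of subsets none containing another (members: hyperedges). A transversal is an inclusion-minimal set meeting every hyperedge; $\mathrm{b}(\mathcal{C})$ the transversals, $\mathrm{bn}(\mathcal{C})$ the minimum transversal size, $\mathrm{minb}(\mathcal{C})$ the minimum-size transversals; minimum-transversal-covered means $\bigcup\mathrm{minb}(\mathcal{C})=E$. A fractional packing is $y:\mathcal{C}\to\mathbb{R}_{\ge0}$ with $\sum_{H\ni a}y(H)\le1$ for all $a\in E$; $\mathrm{fpn}(\mathcal{C})$ is the maximum of $\sum_Hy(H)$; the integral blocking condition is $\mathrm{fpn}(\mathcal{C})=\mathrm{bn}(\mathcal{C})$. $\tilde{\mathcal{C}}=\{H\in\mathcal{C}:|H\cap B|=1\ \forall B\in\mathrm{minb}(\mathcal{C})\}$. $\mathrm{I}(\mathcal{C})=\{x\in\mathbb{R}^E:\langle x,1_D\rangle=1\ \forall D\in\mathrm{minb}(\mathcal{C}),\ \langle x,1_D\rangle\ge1\ \forall D\in\mathrm{b}(\mathcal{C}),\ x\ge0\}$; an integral simplex is a simplex with integral vertices. Dimension condition: (affine dimension of $\{1_H:H\in\tilde{\mathcal{C}}\}$)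 + (affine dimension of $\{1_B:B\in\mathrm{minb}(\tilde{\mathcal{C}})\}$) $=|E|-1$. For $A\subseteq E$, $\mathcal{C}\setminus A=\{X\in\mathcal{C}:X\cap A=\emptyset\}$. A minimum-transversal-covered clutter with the integral blocking condition is hyperedge-separable if some $H\in\tilde{\mathcal{C}}$ has $\mathrm{bn}(\mathcal{C}\setminus H)=\mathrm{bn}(\mathcal{C})-1$, and hyperedge-nonseparable if $\mathrm{bn}(\mathcal{C}\setminus H)<\mathrm{bn}(\mathcal{C})-1$ for all $H\in\tilde{\mathcal{C}}$. For $H\in\tilde{\mathcal{C}}$, a facet transversal of $H$ is a $B\in\mathrm{b}(\tilde{\mathcal{C}})$ with $|H\cap B|>1$, $|B\setminus H|\le\mathrm{bn}(\mathcal{C})-2$, and $|H'\cap B|=1$ for all $H'\in\tilde{\mathcal{C}}\setminus\{H\}$. *)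

(* Defs.v *)
From mathcomp Require Import all_boot all_order all_algebra.
From mathcomp Require Import reals.

Set Implicit Arguments.
Unset Strict Implicit.
Unset Printing Implicit Defensive.

Import Order.TTheory GRing.Theory Num.Theory.
Local Open Scope ring_scope.

Section Clutters.
Variable E : finType.
Implicit Types (C : {set {set E}}) (A B H : {set E}).

Definition clutter C : Prop :=
  forall H H', H \in C -> H' \in C -> H \subset H' -> H = H'.

Definition meets_all C B : bool := [forall H in C, H :&: B != set0].

Definition transversals C : {set {set E}} :=
  [set B | minset (meets_all C) B].

(* Since #|B| <= #|E|, the default value #|E| only matters when C has no
   transversal, i.e. when set0 \in C. *)
Definition bn C : nat := \big[minn/#|E|]_(B in transversals C) #|B|.

Definition minb C : {set {set E}} := [set B in transversals C | #|B| == bn C].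

Definition min_transversal_covered C : Prop :=
  \bigcup_(B in minb C) B = [set: E].

Definition tilde C : {set {set E}} :=
  [set H in C | [forall B in minb C, #|H :&: B| == 1%N]].

Definition deletion C A : {set {set E}} := [set X in C | [disjoint X & A]].

(* bn (C \ H) < bn C - 1 with the integer subtraction: 1 is moved to the left
   because the subtraction of nat truncates. *)
Definition hyperedge_nonseparable C : Prop :=
  forall H, H \in tilde C -> (bn (deletion C H) + 1 < bn C)%N.

(* As above, #|B :\: H| <= bn C - 2 is written without subtraction. *)
Definition facet_transversal C H B : Prop :=
  [/\ B \in transversals (tilde C),
      (1 < #|H :&: B|)%N,
      (#|B :\: H| + 2 <= bn C)%N
    & forall H', H' \in tilde C -> H' != H -> #|H' :&: B| = 1%N].

End Clutters.

Section Affine.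
Variables (R : realType) (V : vectType R).

(* The affine dimension of the empty set is -1. *)
Definition affine_dim (s : seq V) : int :=
  if s is [::] then -1
  else (\dim <<[seq p - q | p <- s, q <- s]>>%VS)%:Z.

Definition affinely_independent n (v : 'I_n -> V) : Prop :=
  forall c : 'I_n -> R,
    \sum_i c i = 0 -> \sum_i c i *: v i = 0 -> forall i, c i = 0.

Definition convex_hull n (v : 'I_n -> V) (x : V) : Prop :=
  exists c : 'I_n -> R,
    [/\ forall i, 0 <= c i, \sum_i c i = 1 & x = \sum_i c i *: v i].

End Affine.

Section Real.
Variables (R : realType) (E : finType).
Implicit Types (C : {set {set E}}) (H D : {set E}).

(* R^o makes the space R^E a vectType over R. *)
Local Notation RE := {ffun E -> R^o}.

Definition indicator D : RE := [ffun a => (a \in D)%:R].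

Definition inner (x y : RE) : R := \sum_a x a * y a.

(* Only the values of y on C matter. *)
Definition fractional_packing C (y : {set E} -> R) : Prop :=
  (forall H, H \in C -> 0 <= y H) /\
  (forall a : E, \sum_(H in C | a \in H) y H <= 1).

Definition is_fpn C (r : R) : Prop :=
  (exists2 y, fractional_packing C y & \sum_(H in C) y H = r) /\
  (forall y, fractional_packing C y -> \sum_(H in C) y H <= r).

Definition integral_blocking C : Prop := is_fpn C (bn C)%:R.

Definition I_polyhedron C (x : RE) : Prop :=
  [/\ forall D, D \in minb C -> inner x (indicator D) = 1,
      forall D, D \in transversals C -> 1 <= inner x (indicator D)
    & forall a, 0 <= x a].

(* The case n = 0 is the empty simplex, of dimension -1. *)
Definition integral_simplex (P : RE -> Prop) : Prop :=
  exists n (v : 'I_n -> RE),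
    [/\ affinely_independent v,
        forall i a, (v i a : R) \is a Num.int
      & forall x, P x <-> convex_hull v x].

Definition dimension_condition C : Prop :=
  affine_dim [seq indicator H | H in tilde C] +
  affine_dim [seq indicator B | B in minb (tilde C)] = #|E|%:Z - 1.

End Real.

(* Main.v *)
(* Write b = bn C. By complementary slackness an optimal fractional packing y
   satisfies sum_(H containing a) y_H = 1 for every a, so the point 1_E / b lies
   in I(C), where it satisfies strictly all inequalities except those of the
   minimum transversals, and sum_H y_H |H :&: A| = |A| for every A. The integral
   points of I(C) are exactly the vectors 1_H, hence they are its vertices when
   it is an integral simplex.

   Since all products <1_H, 1_B> with B minimum are 1, the dimension condition
   says that every vector orthogonal to all these 1_B is in the span of the 1_H;
   perturbing 1_E / b in such directions gives it from I(C) = conv {1_H}.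

   If C is nonseparable then y_H < 1. The facet of the simplex opposite to 1_H
   is then not of the form x_a = 0, so it is <x, 1_B> = 1 for some transversal B,
   and |B| = b + y_H (|H :&: B| - 1) yields |B :\: H| <= b - 2. Conversely,
   pairing sum_H c_H 1_H with the facet transversal of H isolates c_H, which
   gives both affine independence and nonnegative barycentric coordinates,
   while B :\: H meets every hyperedge disjoint from H. *)
Require Import Defs.
From mathcomp Require Import all_boot all_order all_algebra.
From mathcomp Require Import reals.
From mathcomp Require Import zify ring lra.
From HB Require Import structures.

Set Implicit Arguments.
Unset Strict Implicit.
Unset Printing Implicit Defensive.

Import Order.TTheory GRing.Theory Num.Theory.
Local Open Scope ring_scope.

(** * Transversals and the minimum transversal size *)

Section Clutters.
Variable E : finType.
Implicit Types (C : {set {set E}}) (A B H : {set E}).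

Lemma transversal_meets C B H :
  B \in transversals C -> H \in C -> H :&: B != set0.
Proof. by rewrite inE => /minsetp /forall_inP; apply. Qed.

Lemma sub_transversal C A :
  meets_all C A -> exists2 B, B \in transversals C & B \subset A.
Proof. by move=> /minset_exists [B ? ?]; exists B; rewrite ?inE. Qed.

Lemma leq_bn C B : B \in transversals C -> (bn C <= #|B|)%N.
Proof.
move=> BC; have := mem_index_enum B; rewrite /bn.
elim: (index_enum _) => //= B' s IHs; rewrite inE big_cons => /predU1P[<-|Bs].
  by rewrite BC geq_minl.
by case: ifP => _; rewrite ?geq_min IHs ?orbT.
Qed.

Lemma bn_max C : (bn C <= #|E|)%N.
Proof.
rewrite /bn; elim/big_ind: _ => // [m n mE nE|B _]; last exact: max_card.
by rewrite geq_min mE.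
Qed.

Lemma bn_attained C : set0 \notin C ->
  exists2 B, B \in transversals C & #|B| = bn C.
Proof.
move=> C0.
have [] := @sub_transversal C [set: E].
  apply/forall_inP => H HC; rewrite setIT.
  by apply: contraNneq C0 => <-.
move=> B0 B0C _.
have : bn C = #|E| \/ exists2 B, B \in transversals C & #|B| = bn C.
  rewrite /bn; elim/big_ind: _ => [|m n IHm IHn|B BC]; first by left.
    by case: (leqP m n) => _.
  by right; exists B.
(* If the minimum is the default value [#|E|], any transversal attains it. *)
case=> // bnE; exists B0 => //; apply/eqP.
by rewrite eqn_leq leq_bn // bnE max_card.
Qed.

(** Otherwise [~: A] meets every hyperedge and so contains a transversal, which [A] misses. *)
Lemma meets_transversals_sub C A :
  {in transversals C, forall B, A :&: B != set0} ->
  exists2 H, H \in C & H \subset A.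
Proof.
move=> meetA; apply/exists_inP; apply: contraT => /exists_inPn noH.
have [|B BC BA] := @sub_transversal C (~: A).
  apply/forall_inP => H /noH; apply: contra => /eqP HA.
  by rewrite -[A]setCK -disjoints_subset -setI_eq0 HA.
by have /negP[] := meetA B BC; rewrite setI_eq0 disjoint_sym disjoints_subset.
Qed.

End Clutters.

(** * Inner product, orthogonal complements and affine dimension *)

Section Inner.
Variables (R : realType) (E : finType).
Local Notation RE := {ffun E -> R^o}.
Implicit Types (x y u w : RE) (A B : {set E}).

Lemma innerC x y : inner x y = inner y x.
Proof. by apply: eq_bigr => a _; rewrite mulrC. Qed.

(** Takes [y] first so that the partial application is a linear form in [x]. *)
Definition innerr y x : R := inner x y.

Lemma innerr_linear y : linear_for *%R (innerr y).
Proof.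
move=> k u v; rewrite /innerr /inner mulr_sumr -big_split; apply: eq_bigr => a _.
by rewrite !ffunE /= mulrDl mulrA.
Qed.

HB.instance Definition _ y :=
  GRing.isLinear.Build R RE R *%R (innerr y) (innerr_linear y).

Lemma innerDl x u y : inner (x + u) y = inner x y + inner u y.
Proof. exact: (raddfD (innerr y)). Qed.

Lemma inner0l y : inner 0 y = 0.
Proof. exact: (raddf0 (innerr y)). Qed.

Lemma innerBl x u y : inner (x - u) y = inner x y - inner u y.
Proof. exact: (raddfB (innerr y)). Qed.

Lemma innerZl k x y : inner (k *: x) y = k * inner x y.
Proof. exact: (scalarZ (innerr y)). Qed.

Lemma inner_suml I r (P : pred I) (F : I -> RE) y :
  inner (\sum_(i <- r | P i) F i) y = \sum_(i <- r | P i) inner (F i) y.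
Proof. exact: (raddf_sum (innerr y)). Qed.

Lemma inner_self_eq0 x : inner x x = 0 -> x = 0.
Proof.
move=> /psumr_eq0P x0; apply/ffunP => a; rewrite ffunE.
by apply/eqP; rewrite -sqrf_eq0 expr2 x0 // => b _; rewrite -expr2 sqr_ge0.
Qed.

Lemma inner_indicator x A : inner x (indicator R A) = \sum_(a in A) x a.
Proof.
rewrite [RHS]big_mkcond; apply: eq_bigr => a _; rewrite ffunE.
by case: ifP; rewrite ?mulr1 ?mulr0.
Qed.

Lemma inner_indicators A B : inner (indicator R A) (indicator R B) = #|A :&: B|%:R.
Proof.
rewrite inner_indicator (eq_bigr (fun a => (a \in A)%:R)); last first.
  by move=> a _; rewrite ffunE.
rewrite -natr_sum -sum1_card; congr (_%:R).
rewrite [RHS](eq_bigl (fun a => (a \in B) && (a \in A))); last first.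
  by move=> a; rewrite inE andbC.
by rewrite big_mkcondr; apply: eq_bigr => a _; case: ifP.
Qed.

Lemma inner_span0 (s : seq RE) w u :
  {in s, forall p, inner p u = 0} -> w \in <<s>>%VS -> inner w u = 0.
Proof.
move=> su ws; rewrite [w](coord_span (X := in_tuple s)) //.
rewrite inner_suml big1 // => i _.
by rewrite innerZl su ?mulr0 // mem_nth.
Qed.

Definition coords (s : seq RE) (x : RE) : 'rV[R]_(size s) :=
  \row_i inner x s`_i.

Lemma coords_linear s : linear (coords s).
Proof. by move=> k u v; apply/rowP => i; rewrite !mxE innerDl innerZl. Qed.

HB.instance Definition _ s :=
  GRing.isLinear.Build R RE _ *:%R (coords s) (coords_linear s).

Definition orthocomplement (s : seq RE) : {vspace RE} := lker (linfun (coords s)).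

Lemma orthocomplementP s w :
  reflect {in s, forall p, inner w p = 0} (w \in orthocomplement s).
Proof.
rewrite memv_ker lfunE /=; apply: (iffP eqP) => [w0 p /(nthP 0) [i ltis <-]|w0].
  by have /rowP/(_ (Ordinal ltis)) := w0; rewrite !mxE.
by apply/rowP => i; rewrite !mxE w0 // mem_nth.
Qed.

(** Passing to a basis makes the number of coordinates equal to [\dim <<s>>], as the rank-nullity
    argument below requires. *)
Lemma orthocomplement_span s : orthocomplement (vbasis <<s>>) = orthocomplement s.
Proof.
apply/vspaceP => w; apply/orthocomplementP/orthocomplementP => w0 p ps; rewrite innerC.
  apply: (@inner_span0 (vbasis <<s>>)) => [q qs|]; first by rewrite innerC w0.
  by rewrite (span_basis (vbasisP _)) memv_span.
apply: (@inner_span0 s) => [q qs|]; first by rewrite innerC w0.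
exact: vbasis_mem.
Qed.

(** At most: positive definiteness makes the complement meet the span trivially. At least:
    rank-nullity for [coords]. *)
Lemma dim_orthocomplement s : (\dim (orthocomplement s) + \dim <<s>>)%N = #|E|.
Proof.
have dimRE : \dim {:RE} = #|E| by rewrite dimvf /dim /= muln1.
apply/eqP; rewrite eqn_leq; apply/andP; split.
  rewrite -dimv_disjoint_sum -?dimRE ?dimvS ?subvf //.
  apply/eqP; rewrite -subv0; apply/subvP => w /memv_capP [wo ws].
  rewrite memv0; apply/eqP/inner_self_eq0; apply: inner_span0 ws => p ps.
  by rewrite innerC; apply: (orthocomplementP _ _ wo).
rewrite -orthocomplement_span -dimRE -(limg_ker_dim (linfun (coords (vbasis <<s>>))) fullv).
rewrite capfv leq_add2l -[leqRHS](size_tuple (vbasis <<s>>)).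
by rewrite (leq_trans (dimvS (subvf _))) // dimvf /dim /= mul1n.
Qed.

Definition differences (s : seq RE) : seq RE := [seq p - q | p <- s, q <- s].

Lemma affine_dimE s : s != [::] -> affine_dim s = (\dim <<differences s>>)%:Z.
Proof. by case: s. Qed.

Section Hyperplane.
Variables (s : seq RE) (u : RE).
Hypotheses (s_neq0 : s != [::]) (s_u : {in s, forall p, inner p u = 1}).

Lemma inner_differences w : w \in <<differences s>>%VS -> inner w u = 0.
Proof.
apply: inner_span0 => _ /allpairsP [[p q] /= [ps qs ->]].
by rewrite innerBl !s_u // subrr.
Qed.

Lemma span_differences p0 : p0 \in s -> (<<s>> = <<differences s>> + <[p0]>)%VS.
Proof.
move=> p0s; apply/eqP; rewrite eqEsubv; apply/andP; split.
  apply/span_subvP => p ps; rewrite -(subrK p0 p) memv_add ?memv_line //.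
  by apply/memv_span/allpairs_f.
rewrite subv_add -memvE memv_span // andbT; apply/span_subvP.
by move=> _ /allpairsP [[p q] /= [ps qs ->]]; rewrite memvB ?memv_span.
Qed.

(** An element of the span is a direction plus a multiple of [p0], and pairing with [u] reads off
    that multiple. *)
Lemma mem_span_differences w :
  (w \in <<differences s>>%VS) = (w \in <<s>>%VS) && (inner w u == 0).
Proof.
have [p0 p0s] : exists p0, p0 \in s by case: s s_neq0 => // p ? _; exists p; exact: mem_head.
rewrite (span_differences p0s); apply/idP/andP => [wd|[]].
  by rewrite (subvP (addvSl _ _)) // inner_differences.
case/memv_addP => d dd [_ /vlineP [k ->] ->].
rewrite innerDl inner_differences // innerZl s_u // mulr1 add0r => /eqP ->.
by rewrite scale0r addr0.
Qed.

(** The hyperplane containing [s] misses the origin, so a point of [s] adds one dimension to the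
    directions. *)
Lemma dim_span_affine : (\dim <<s>>)%:Z = affine_dim s + 1.
Proof.
rewrite affine_dimE //.
have [p0 p0s] : exists p0, p0 \in s by case: s s_neq0 => // p ? _; exists p; exact: mem_head.
rewrite (span_differences p0s) dimv_disjoint_sum ?dim_vline.
  suff -> : p0 != 0 by rewrite PoszD.
  apply/eqP => p00; have := s_u p0s; rewrite p00 inner0l => /eqP.
  by rewrite eq_sym oner_eq0.
apply/eqP; rewrite -subv0; apply/subvP => w /memv_capP [wd /vlineP [k wE]].
have := inner_differences wd; rewrite wE innerZl s_u // mulr1 => ->.
by rewrite scale0r mem0v.
Qed.

End Hyperplane.

(** The directions of [s] lie in [orthocomplement t], whose dimension is [#|E| - 1] minus the affine
    dimension of [t]; the equation says that they fill it. *)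
Lemma affine_dim_complementary (s t : seq RE) :
  s != [::] -> t != [::] ->
  {in s & t, forall p q, inner p q = 1} ->
  (affine_dim s + affine_dim t = #|E|%:Z - 1) <->
  (orthocomplement t <= <<s>>)%VS.
Proof.
move=> s0 t0 st.
have [p ps] : exists p, p \in s by case: (s) s0 => // p ? _; exists p; exact: mem_head.
have [q qt] : exists q, q \in t by case: (t) t0 => // q ? _; exists q; exact: mem_head.
have sq : {in s, forall p', inner p' q = 1} by move=> p' p's; apply: st.
have tp : {in t, forall q', inner q' p = 1} by move=> q' q't; rewrite innerC st.
have sub : (<<differences s>> <= orthocomplement t)%VS.
  apply/subvP => w ws; apply/orthocomplementP => q' q't.
  by apply: inner_differences ws => p' p's; apply: st.
have arith (a b c d n : nat) : c%:Z = b%:Z + 1 -> (d + c)%N = n ->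
    (a <= d)%N -> (a%:Z + b%:Z = n%:Z - 1) <-> (d <= a)%N by lia.
have := dim_span_affine t0 tp; rewrite !affine_dimE // => dimt.
rewrite (arith _ _ _ _ _ dimt (dim_orthocomplement t) (dimvS sub)).
transitivity ((orthocomplement t <= <<differences s>>)%VS).
  split=> [leot|/dimvS //].
  have /eqP <- : <<differences s>>%VS == orthocomplement t by rewrite eqEdim sub.
  exact: subvv.
split=> /subvP os; apply/subvP => w wo.
  by have := os w wo; rewrite (mem_span_differences s0 sq) => /andP[].
by rewrite (mem_span_differences s0 sq) os //= (orthocomplementP _ _ wo).
Qed.

End Inner.

(** Used with [m i] the size of the intersection with a facet transversal, where only [i0] departs
    from 1. *)
Lemma sum_weighted_single (R : comNzRingType) (I : finType) (P : pred I)
    (c m : I -> R) i0 :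
  P i0 -> (forall i, P i -> i != i0 -> m i = 1) ->
  \sum_(i | P i) c i * m i = \sum_(i | P i) c i + c i0 * (m i0 - 1).
Proof.
move=> Pi0 m1; rewrite (bigD1 i0) //= [in RHS](bigD1 i0) //=.
rewrite (eq_bigr c) => [|i /andP [Pi ii0]]; last by rewrite m1 ?mulr1.
by ring.
Qed.

Lemma mem_span_image (K : fieldType) (vT : vectType K) (I : finType)
    (A : {set I}) (v : I -> vT) x :
  x \in <<[seq v i | i in A]>>%VS ->
  exists c : I -> K, x = \sum_(i in A) c i *: v i.
Proof.
rewrite span_def big_map big_enum /= => /memv_sumP [vs vsP ->].
have /fin_all_exists [c cP] : forall i, exists k, i \in A -> vs i = k *: v i.
  move=> i; case: (boolP (i \in A)) => [iA|_]; last by exists 0.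
  by have /vlineP [k ->] := vsP i iA; exists k.
by exists c; apply: eq_bigr => i /cP.
Qed.

(** * Packings and the polyhedron I(C) *)

Section Polyhedron.
Variables (R : realType) (E : finType) (C : {set {set E}}).
Local Notation RE := {ffun E -> R^o}.
Implicit Types (x w : RE) (y : {set E} -> R) (A B D H : {set E}).

Lemma sum_packing y A :
  \sum_(H in C) y H * #|H :&: A|%:R = \sum_(a in A) \sum_(H in C | a \in H) y H.
Proof.
rewrite (exchange_big_dep (mem C)) /=; last by move=> a H _ /andP[].
apply: eq_bigr => H HC; rewrite HC /= -sum1_card natr_sum mulr_sumr.
by apply: eq_big => [a|a _]; rewrite ?mulr1 // inE andbC.
Qed.

Lemma inner_combination n (h : 'I_n -> {set E}) (c : 'I_n -> R) A :
  inner (\sum_i c i *: indicator R (h i)) (indicator R A) =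
  \sum_i c i * #|h i :&: A|%:R.
Proof.
by rewrite inner_suml; apply: eq_bigr => i _; rewrite innerZl inner_indicators.
Qed.

Lemma convex_hull_vertex n (v : 'I_n -> RE) i : convex_hull v (v i).
Proof.
exists (fun j => (j == i)%:R); split=> [j||]; first by rewrite ler0n.
  by rewrite (bigD1 i) //= eqxx big1 ?addr0 // => j /negPf ->.
rewrite (bigD1 i) //= eqxx scale1r big1 ?addr0 // => j /negPf ->.
by rewrite scale0r.
Qed.

Lemma I_polyhedron_convex n (v : 'I_n -> RE) x :
  (forall i, I_polyhedron C (v i)) -> convex_hull v x -> I_polyhedron C x.
Proof.
move=> vI [c [c0 c1 ->]]; split=> [D Dm|D Dt|a].
- rewrite inner_suml -c1; apply: eq_bigr => i _; rewrite innerZl.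
  by have [-> // _ _] := vI i; rewrite mulr1.
- rewrite inner_suml -c1; apply: ler_sum => i _; rewrite innerZl.
  by have [_ vD _] := vI i; rewrite ler_peMr // vD.
- rewrite sum_ffunE; apply: sumr_ge0 => i _; rewrite ffunE /=.
  by have [_ _ va] := vI i; rewrite mulr_ge0.
Qed.

Hypothesis covered : min_transversal_covered C.

Lemma mem_minb_covered a : exists2 B, B \in minb C & a \in B.
Proof.
by have := in_setT a; rewrite -covered => /bigcupP [B ? ?]; exists B.
Qed.

Hypothesis blocking : integral_blocking R C.

(** If [set0] were a hyperedge there would be no transversal, so covering would leave [E] empty.
    Weight 1 on every hyperedge would then be a packing of positive total, while [bn C] is 0. *)
Lemma set0_notin_blocking : set0 \notin C.
Proof.
apply/negP => C0.
have noE (a : E) : False.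
  have [B + _] := mem_minb_covered a; rewrite inE => /andP [BC _].
  by have := transversal_meets BC C0; rewrite set0I eqxx.
have [_ /(_ (fun=> 1)) max1] := blocking.
have /max1 : fractional_packing C (fun=> 1 : R).
  by split=> [*|a]; [exact: ler01|case: (noE a)].
apply/negP; rewrite -ltNge sumr_const ltr_nat.
rewrite (leq_ltn_trans (bn_max C)) // (@leq_ltn_trans 0%N) //; last first.
  by apply/card_gt0P; exists set0.
by rewrite leqn0; apply/pred0P => a; case: (noE a).
Qed.

Lemma exists_minb : exists B, B \in minb C.
Proof.
have [B BC Bb] := bn_attained set0_notin_blocking.
by exists B; rewrite inE BC Bb eqxx.
Qed.

Lemma bn_gt0 : C != set0 -> (0 < bn C)%N.
Proof.
case/set0Pn => H HC; have [B BC <-] := bn_attained set0_notin_blocking.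
rewrite card_gt0; apply: contraTneq (transversal_meets BC HC) => ->.
by rewrite setI0 eqxx.
Qed.

Hypothesis uniform : C = tilde C.

Lemma card_minb H B : H \in C -> B \in minb C -> #|H :&: B| = 1%N.
Proof. by rewrite {1}uniform inE => /andP [_ /forall_inP HC] /HC /eqP. Qed.

(* Complementary slackness: an optimal packing saturates every element of a
   minimum transversal, hence every element. *)
Lemma exists_perfect_packing : exists y,
  [/\ forall H, H \in C -> 0 <= y H,
      forall a, \sum_(H in C | a \in H) y H = 1
    & \sum_(H in C) y H = (bn C)%:R].
Proof.
have [[y [y0 y1] yb] _] := blocking; exists y; split=> // a.
have [B Bm aB] := mem_minb_covered a.
pose slack b := 1 - \sum_(H in C | b \in H) y H.
suff slack0 : \sum_(b in B) slack b = 0.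
  have /eqP : slack a = 0.
    by apply: psumr_eq0P slack0 _ aB => b _; rewrite subr_ge0.
  by rewrite subr_eq0 eq_sym => /eqP.
rewrite sumrB -sum_packing (eq_bigr y) => [|H HC]; last first.
  by rewrite card_minb // mulr1.
rewrite yb sumr_const; move: Bm.
by rewrite inE => /andP [_ /eqP ->]; rewrite subrr.
Qed.

(** * Integral points and vertices of I(C) *)

Lemma I_polyhedron_indicator H : H \in C -> I_polyhedron C (indicator R H).
Proof.
move=> HC; split=> [D Dm|D Dt|a].
- by rewrite inner_indicators card_minb.
- rewrite inner_indicators ler1n card_gt0 (transversal_meets Dt) //.
- by rewrite ffunE ler0n.
Qed.

(** Covering by minimum transversals bounds each coordinate by 1, so [x] is the indicator of a set
    [S]. [S] meets every transversal, hence contains a hyperedge [H]; both meet each minimum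
    transversal exactly once, so they agree there and thus everywhere. *)
Lemma I_polyhedron_integral x :
  I_polyhedron C x -> (forall a, (x a : R) \is a Num.int) ->
  exists2 H, H \in C & x = indicator R H.
Proof.
move=> [xm xt x0] xint.
pose S := [set a | x a == 1 :> R].
have xS : x = indicator R S.
  apply/ffunP => a; rewrite ffunE inE; have [B Bm aB] := mem_minb_covered a.
  have : x a <= 1 :> R.
    rewrite -(xm B Bm) inner_indicator (bigD1 a) //= lerDl.
    by apply: sumr_ge0 => b _; apply: x0.
  have := x0 a; have /intrP [m ->] := xint a.
  rewrite ler0z -[1]/(1%:~R) ler_int eqr_int => m0 m1.
  by have [->|->] : m = 0 \/ m = 1 by lia.
have [|H HC HS] := @meets_transversals_sub E C S.
  move=> B BC; rewrite -card_gt0 -(ler1n R) -inner_indicators -xS.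
  exact: xt.
exists H => //; rewrite xS; congr (indicator R _); apply/eqP.
rewrite eqEsubset HS andbT; apply/subsetP => a aS.
have [B Bm aB] := mem_minb_covered a.
have /eqP : H :&: B == S :&: B.
  rewrite eqEcard setSI // (card_minb HC Bm).
  by have /eqP := xm B Bm; rewrite xS inner_indicators pnatr_eq1 => /eqP ->.
by move/setP/(_ a); rewrite !inE aB !andbT => ->; rewrite inE in aS.
Qed.

(** Every hyperedge occurs as a vertex: in a convex combination equal to [indicator R H], any [h i]
    of nonzero weight is contained in [H], hence equals [H] in a clutter. *)
Lemma integral_simplex_vertices : clutter C ->
  integral_simplex (I_polyhedron (R := R) C) ->
  exists n (h : 'I_n -> {set E}),
    [/\ affinely_independent (fun i => indicator R (h i)),
        forall i, h i \in C,
        forall H, H \in C -> exists i, h i = H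
      & forall x, I_polyhedron C x ->
          convex_hull (fun i => indicator R (h i)) x].
Proof.
move=> Cclutter [n [v [vfree vint vI]]].
have /fin_all_exists2 [h hC hv] : forall i, exists2 H, H \in C & v i = indicator R H.
  by move=> i; apply: I_polyhedron_integral => //; apply/vI/convex_hull_vertex.
have hull x : I_polyhedron C x -> convex_hull (fun i => indicator R (h i)) x.
  move=> /vI [c [c0 c1 ->]]; exists c; split=> //.
  by apply: eq_bigr => i _; rewrite hv.
exists n, h; split=> // [c c1 cv|H HC].
  by apply: vfree c1 _; rewrite -[RHS]cv; apply: eq_bigr => i _; rewrite hv.
have [c [c0 c1 cv]] := hull _ (I_polyhedron_indicator HC).
have /existsP [i ci] : [exists i, c i != 0].
  apply: contraT => /existsPn cz; move: c1; rewrite big1 => [/eqP|i _].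
    by rewrite eq_sym oner_eq0.
  by apply/eqP; rewrite -[_ == _]negbK.
exists i; apply: Cclutter => //; apply/subsetP => a ah.
have := congr1 (fun f : RE => f a) cv; rewrite sum_ffunE !ffunE.
case: (a \in H) => // /esym /psumr_eq0P /= ca.
have := ca _ i isT; rewrite !ffunE /= ah => ci0.
move/eqP: ci; case.
rewrite -[LHS]mulr1; apply: ci0 => j _.
by rewrite !ffunE /= mulr_ge0 ?ler0n.
Qed.

(** * The dimension condition, by perturbing the centre of I(C) *)

Lemma I_polyhedron_near_center w : C != set0 ->
  {in minb C, forall B, inner w (indicator R B) = 0} ->
  \sum_a `|w a : R| <= 1 ->
  I_polyhedron C ((bn C)%:R^-1 *: (indicator R [set: E] + w)).
Proof.
move=> Cn0 wm w1; have b0 : 0 < (bn C)%:R :> R by rewrite ltr0n bn_gt0.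
have wle A : - 1 <= inner w (indicator R A).
  rewrite lerNl (le_trans _ w1) // inner_indicator -sumrN big_mkcond /=.
  apply: ler_sum => a _; case: ifP => // _.
  by rewrite -normrN ler_norm.
split=> [D|D|a].
- move=> Dm; rewrite innerZl innerDl inner_indicators setTI wm // addr0.
  by move: Dm; rewrite inE => /andP [_ /eqP ->]; rewrite mulVf ?gt_eqF.
- move=> Dt; rewrite innerZl innerDl inner_indicators setTI ler_pdivlMl // mulr1.
  (* A transversal that is not minimum has at least [bn C + 1] elements, and this slack of 1 absorbs
     [w]. *)
  have := leq_bn Dt; rewrite leq_eqVlt => /predU1P [Db|ltD].
    rewrite wm ?addr0 ?ler_nat ?Db //.
    by rewrite inE Dt Db eqxx.
  rewrite -lerBlDr (le_trans _ (_ : (bn C).+1%:R <= _)) ?ler_nat //.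
  by rewrite -natr1 lerD2l lerNl wle.
- rewrite !ffunE inE /= mulr_ge0 ?invr_ge0 ?ler0n //.
  have : `|w a : R| <= 1.
    rewrite (le_trans _ w1) // (bigD1 a) //= lerDl.
    by apply: sumr_ge0 => b _.
  by rewrite ler_norml => /andP [+ _]; rewrite -lerBlDl sub0r.
Qed.

Lemma indicators_neq0 (F : {set {set E}}) :
  F != set0 -> [seq indicator R A | A in F] != [::].
Proof. by rewrite -!size_eq0 size_map -cardE cards_eq0. Qed.

Lemma dimension_conditionP : C != set0 ->
  dimension_condition R C <->
  (orthocomplement [seq indicator R B | B in minb C] <=
   <<[seq indicator R H | H in C]>>)%VS.
Proof.
move=> Cn0; rewrite /dimension_condition -uniform.
apply: affine_dim_complementary => [||p q /imageP [H HC ->] /imageP [B Bm ->]].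
- exact: indicators_neq0.
- by apply/indicators_neq0/set0Pn; exact: exists_minb.
- by rewrite inner_indicators card_minb.
Qed.

Lemma dimension_condition_hull n (h : 'I_n -> {set E}) :
  C != set0 -> (forall i, h i \in C) ->
  (forall x, I_polyhedron C x -> convex_hull (fun i => indicator R (h i)) x) ->
  dimension_condition R C.
Proof.
move=> Cn0 hC hull; apply/(dimension_conditionP Cn0).
have span x : I_polyhedron C x -> x \in <<[seq indicator R H | H in C]>>%VS.
  move=> /hull [c [_ _ ->]]; apply: memv_suml => i _.
  by apply/memvZ/memv_span/image_f.
apply/subvP => w /orthocomplementP wm.
(* Scales [w] to l1-norm at most 1; the summand 1 keeps the denominator positive when [w] is 0. *)
pose e := (1 + \sum_a `|w a : R|)^-1.
have sum_ge0 : 0 <= \sum_a `|w a : R| by apply: sumr_ge0 => a _.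
have e0 : 0 < e by rewrite invr_gt0 ltr_pwDl.
have b0 : (bn C)%:R != 0 :> R by rewrite pnatr_eq0 -lt0n bn_gt0.
have xw : I_polyhedron C ((bn C)%:R^-1 *: (indicator R [set: E] + e *: w)).
  apply: I_polyhedron_near_center => // [B Bm|].
    by rewrite innerZl wm ?mulr0 // image_f.
  rewrite (eq_bigr (fun a => e * `|w a : R|)) => [|a _]; last first.
    by rewrite ffunE /= normrM gtr0_norm.
  by rewrite -mulr_sumr mulrC ler_pdivrMr ?mul1r ?lerDr // ltr_pwDl.
have x0 : I_polyhedron C ((bn C)%:R^-1 *: (indicator R [set: E] + 0)).
  apply: I_polyhedron_near_center => // [B Bm|]; first by rewrite inner0l.
  by rewrite big1 ?ler01 // => a _; rewrite ffunE normr0.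
have -> : w = (e^-1 * (bn C)%:R) *:
    ((bn C)%:R^-1 *: (indicator R [set: E] + e *: w) -
     (bn C)%:R^-1 *: (indicator R [set: E] + 0)).
  rewrite -scalerBr addr0 addrC addKr !scalerA mulfK //.
  by rewrite mulVf ?scale1r // gt_eqF.
by rewrite memvZ // memvB // span.
Qed.

(** A perfect packing by no hyperedges forces [E] to be empty, and the condition reads -1 + 0 = 0 -
    1. *)
Lemma dimension_condition_set0 : C = set0 -> dimension_condition R C.
Proof.
move=> C0; rewrite /dimension_condition -uniform.
have E0 : #|E| = 0%N.
  apply/eqP; rewrite -leqn0 leqNgt; apply/negP => /card_gt0P [a _].
  have [y [_ /(_ a) + _]] := exists_perfect_packing.
  by rewrite C0 big1 => [/eqP|H]; rewrite ?inE // eq_sym oner_eq0.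
have -> : [seq indicator R H | H in C] = [::].
  by apply: size0nil; rewrite size_map -cardE C0 cards0.
have dim0 := dim_orthocomplement (differences [seq indicator R B | B in minb C]).
rewrite [X in _ + X]affine_dimE; last by apply/indicators_neq0/set0Pn; exact: exists_minb.
by move: dim0; rewrite E0 => /eqP; rewrite addn_eq0 => /andP [_ /eqP ->].
Qed.

(** * From nonseparability to facet transversals *)

Section PerfectPacking.
Variable y : {set E} -> R.
Hypotheses (y_ge0 : forall H, H \in C -> 0 <= y H)
  (y_cover : forall a, \sum_(H in C | a \in H) y H = 1)
  (y_total : \sum_(H in C) y H = (bn C)%:R).

Lemma packing_card A : \sum_(H in C) y H * #|H :&: A|%:R = #|A|%:R.
Proof. by rewrite sum_packing (eq_bigr (fun=> 1)) // sumr_const. Qed.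

(** If [y H] were at least 1, hyperedges meeting [H] would get weight 0. A minimum transversal [T]
    of the deletion would then satisfy [bn C - 1 <= #|T|], by counting weights on [T]. *)
Lemma packing_lt1 H : hyperedge_nonseparable C -> H \in C -> y H < 1.
Proof.
move=> nonsep HC; rewrite ltNge; apply/negP => yH1.
have del0 : set0 \notin deletion C H.
  by rewrite inE negb_and set0_notin_blocking.
have [T Tt Tb] := bn_attained del0.
have := nonsep H; rewrite -uniform => /(_ HC); rewrite -Tb ltnNge => /negP; apply.
rewrite -(ler_nat R) -y_total natrD -packing_card.
rewrite (bigD1 H) //= [in leRHS](bigD1 H) //=.
have yHle : y H <= 1.
  have [a aH] : exists a, a \in H.
    by apply/set0Pn; apply: contraNneq set0_notin_blocking => <-.
  rewrite -(y_cover a) (bigD1 H) /= ?HC // lerDl.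
  by apply: sumr_ge0 => H' /andP [/andP [H'C _] _]; apply: y_ge0.
rewrite addrC lerD //; apply: ler_wpDl; first by rewrite mulr_ge0 ?y_ge0.
apply: ler_sum => H' /andP [H'C H'H].
case: (boolP [disjoint H' & H]) => [dis|].
  rewrite ler_peMr ?y_ge0 // ler1n card_gt0.
  by rewrite (transversal_meets Tt) // inE H'C dis.
rewrite -setI_eq0 => /set0Pn [a]; rewrite inE => /andP [aH' aH].
suff yH' : y H' <= 0 by rewrite (le_trans yH') // mulr_ge0 ?y_ge0.
have := y_cover a.
rewrite (bigD1 H) /= ?HC // (bigD1 H') /= ?H'C ?aH' ?H'H //.
have : 0 <= \sum_(i in C | (a \in i) && (i != H) && (i != H')) y i.
  by apply: sumr_ge0 => i /andP [iC _]; apply: y_ge0.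
rewrite (eq_bigl (fun i => (i \in C) && (a \in i) && (i != H) && (i != H'))).
  lra.
by move=> i; rewrite !andbA.
Qed.

(* If no transversal defined the facet opposite to 1_H, then all inequalities
   of I(C) would survive at a point slightly beyond that facet, namely the
   normalisation of [K * \sum_(H' != H) 1_H' - 1_H] for a large [K]. *)
Lemma facet_transversal_exists n (h : 'I_n -> {set E}) H :
  affinely_independent (fun i => indicator R (h i)) ->
  (forall i, h i \in C) -> (forall H, H \in C -> exists i, h i = H) ->
  (forall x, I_polyhedron C x -> convex_hull (fun i => indicator R (h i)) x) ->
  hyperedge_nonseparable C -> H \in C ->
  exists2 B, B \in transversals C & facet_transversal C H B.
Proof.
move=> hfree hC hsurj hull nonsep HC; have yH := packing_lt1 nonsep HC.
suff [B Bt /andP [HB /forall_inP other]] : exists2 B, B \in transversals C &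
    (1 < #|H :&: B|)%N && [forall H' in C, (H' != H) ==> (#|H' :&: B| == 1%N)].
  have otherE H' : H' \in C -> H' != H -> #|H' :&: B| = 1%N.
    by move=> /other /implyP H'B /H'B /eqP.
  exists B => //; split; rewrite -?uniform //.
  (* This gives [#|B| = bn C + y H * (#|H :&: B| - 1)]; as [y H < 1], the bound is strict, and
     integrality gains the second unit in [bn C - 2]. *)
  have := packing_card B; rewrite (sum_weighted_single _ HC) => [|H' H'C H'H].
    rewrite y_total => cardB.
    have : #|B|%:R < (bn C + #|H :&: B|)%:R - 1 :> R.
      have : 0 < (#|H :&: B|%:R - 1) * (1 - y H).
        by rewrite mulr_gt0 ?subr_gt0 ?ltr1n.
      rewrite natrD -cardB; lra.
    rewrite -(cardsID H B) setIC ltrBrDr natr1 ltr_nat; lia.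
  by rewrite otherE.
apply/exists_inP; apply: contraT => /exists_inPn nofacet; exfalso.
have [i0 hi0] := hsurj H HC.
have other D : D \in transversals C -> (1 < #|H :&: D|)%N ->
    exists2 i, i != i0 & (1 < #|h i :&: D|)%N.
  move=> Dt HD; have := nofacet D Dt; rewrite HD /= negb_forall_in.
  move=> /exists_inP [H' H'C]; rewrite negb_imply => /andP [H'H H'D].
  have [i hi] := hsurj H' H'C; exists i.
    by apply: contraNneq H'H => ii0; rewrite -hi ii0 hi0.
  by rewrite hi ltn_neqAle eq_sym H'D card_gt0 (transversal_meets Dt).
(* An element lying only in [H] would be covered with weight at most [y H < 1]. *)
have otherE a : exists2 i, i != i0 & a \in h i.
  have [/exists_inP [H' /andP [H'C aH'] H'H]|] :=
      boolP [exists H' in [pred H' in C | a \in H'], H' != H].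
    have [i hi] := hsurj H' H'C; exists i; rewrite ?hi //.
    by apply: contraNneq H'H => ii0; rewrite -hi ii0 hi0.
  move=> /exists_inPn only; have := y_cover a; have := yH.
  have y_only : \sum_(H' in C | a \in H') y H' <= y H.
    rewrite big_mkcond (bigD1 H) //= big1 ?addr0 => [|H' H'H].
      by case: ifP => // _; apply: y_ge0.
    by case: ifP => // aH'; have := only H' aH'; rewrite H'H.
  by lra.
(* [K] exceeds 1 and every [#|D :&: H|], so one other hyperedge outweighs the coefficient -1 of
   [H]. *)
pose K := #|E|.+2; pose k i : R := if i == i0 then -1 else K%:R.
have k_gt0 (m : 'I_n -> nat) : (m i0 < K)%N ->
    (exists2 i, i != i0 & (0 < m i)%N) -> 0 < \sum_i k i * (m i)%:R.
  move=> mK [i ii0 mi]; rewrite (bigD1 i0) //= (bigD1 i) //= /k eqxx (negPf ii0).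
  rewrite mulN1r addrC subr_gt0.
  rewrite (lt_le_trans (_ : _ < K%:R * (m i)%:R)) //.
    by rewrite -natrM ltr_nat (leq_trans mK) // leq_pmulr.
  rewrite lerDl; apply: sumr_ge0 => j /andP [/negPf -> _].
  by rewrite mulr_ge0 ?ler0n.
pose N := \sum_i k i.
have N0 : 0 < N.
  have [a aH] : exists a, a \in H.
    by apply/set0Pn; apply: contraNneq set0_notin_blocking => <-.
  have [i ii0 _] := otherE a.
  rewrite /N (eq_bigr (fun i => k i * 1%:R)) => [|j _]; last by rewrite mulr1.
  by apply: (k_gt0 (fun=> 1%N)) => //; exists i.
have kN : \sum_i k i / N = 1 by rewrite -mulr_suml divff ?gt_eqF.
have cardK D : (#|D :&: H| < K)%N by rewrite !ltnS ltnW // ltnS max_card.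
have [c [c0 c1 cx]] : convex_hull (fun i => indicator R (h i))
    (\sum_i (k i / N) *: indicator R (h i)).
  apply: hull; split=> [D Dm|D Dt|a].
  - rewrite inner_combination -[RHS]kN; apply: eq_bigr => i _.
    by rewrite card_minb ?mulr1.
  - rewrite inner_combination -subr_ge0 -[X in _ - X]kN -sumrB.
    (* The predecessor does not truncate, because the transversal [D] meets [h i]. *)
    rewrite (eq_bigr (fun i => k i * (#|h i :&: D|.-1)%:R / N)) => [|i _].
      rewrite -mulr_suml divr_ge0 ?(ltW N0) //.
      have [HD|HD] := ltnP 1 #|H :&: D|.
        have [i ii0 hiD] := other D Dt HD; apply/ltW/k_gt0.
          by rewrite hi0 setIC (leq_ltn_trans (leq_pred _)).
        by exists i => //; move: hiD; case: #|_| => [|[]].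
      apply: sumr_ge0 => i _; rewrite /k; case: eqP => [->|_].
        by rewrite hi0; move: HD; case: #|_| => [|[]] //; rewrite mulr0.
      by rewrite mulr_ge0 ?ler0n.
    have := transversal_meets Dt (hC i); rewrite -card_gt0.
    case: #|_| => // m _; rewrite -natr1 /=; field.
    by rewrite gt_eqF.
  - rewrite sum_ffunE (eq_bigr (fun i => k i * (a \in h i : nat)%:R / N)).
      rewrite -mulr_suml divr_ge0 ?(ltW N0) // ltW // k_gt0 //.
        by rewrite (leq_ltn_trans (leq_b1 _)).
      by have [i ii0 ahi] := otherE a; exists i; rewrite ?ahi.
    by move=> i _; rewrite !ffunE /= mulrAC.
(* Barycentric coordinates are unique, so [c i0] is the negative number [- 1 / N]. *)
have := hfree (fun i => c i - k i / N); rewrite sumrB c1 kN subrr => /(_ erefl).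
rewrite (eq_bigr _ (fun i _ => scalerBl _ _ _)) sumrB -cx subrr => /(_ erefl i0).
move/eqP; rewrite subr_eq0 /k eqxx => /eqP ci0; have := c0 i0.
by rewrite ci0 mulN1r oppr_ge0 leNgt invr_gt0 N0.
Qed.

End PerfectPacking.

(** * From facet transversals to nonseparability and the integral simplex *)

Lemma facets_nonseparable :
  (forall H, H \in C -> exists2 B, B \in transversals C & facet_transversal C H B) ->
  hyperedge_nonseparable C.
Proof.
move=> facets H; rewrite -uniform => HC.
have [B Bt [_ _ Bb _]] := facets H HC.
(* The transversal found in [B :\: H] has at most [bn C - 2] elements, which bounds
   [bn (deletion C H)]. *)
have [|T Tt TB] := @sub_transversal E (deletion C H) (B :\: H).
  apply/forall_inP => X; rewrite inE => /andP [XC XH].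
  have /set0Pn [a] := transversal_meets Bt XC.
  rewrite inE => /andP [aX aB]; apply/set0Pn; exists a.
  by rewrite !inE aX aB andbT (disjointFr XH aX).
have := leq_bn Tt; have := subset_leq_card TB; lia.
Qed.

Lemma facets_integral_simplex :
  dimension_condition R C ->
  (forall H, H \in C -> exists2 B, B \in transversals C & facet_transversal C H B) ->
  integral_simplex (I_polyhedron (R := R) C).
Proof.
move=> dimC facets; have [B0 B0m] := exists_minb.
have facet_coord (c : 'I_#|C| -> R) i : exists2 B, B \in transversals C &
    exists2 k : R, 0 < k &
    inner (\sum_j c j *: indicator R (enum_val j)) (indicator R B) =
      \sum_j c j + c i * k.
  have [B Bt [_ HB _ other]] := facets _ (enum_valP i); exists B => //.
  exists (#|enum_val i :&: B|%:R - 1); first by rewrite subr_gt0 ltr1n.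
  rewrite inner_combination (@sum_weighted_single _ _ _ _ _ i) // => j _ ji.
  rewrite other // -?uniform ?enum_valP //.
  by rewrite (inj_eq enum_val_inj).
have minb_sum (c : 'I_#|C| -> R) :
    inner (\sum_j c j *: indicator R (enum_val j)) (indicator R B0) = \sum_j c j.
  rewrite inner_combination; apply: eq_bigr => j _.
  by rewrite card_minb ?mulr1 ?enum_valP.
exists #|C|, (fun i => indicator R (enum_val i)); split=> [c c0 cv i|i a|x].
- have [B _ [k k0]] := facet_coord c i.
  rewrite cv inner0l c0 add0r => /esym/eqP.
  by rewrite mulf_eq0 (gt_eqF k0) orbF => /eqP.
- by rewrite ffunE natr_int.
split=> [xI|]; last first.
  apply: I_polyhedron_convex => i.
  exact/I_polyhedron_indicator/enum_valP.
have [xm xt _] := xI.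
(* If [C] were empty, so would be [E] and [B0], and [x] would pair with [B0] to 0 instead of 1. *)
have Cn0 : C != set0.
  apply/eqP => C0; have := xm B0 B0m; rewrite inner_indicator.
  case: (set_0Vmem B0) => [->|[a _]].
    by rewrite big_set0 => /eqP; rewrite eq_sym oner_eq0.
  have [y [_ /(_ a) y1 _]] := exists_perfect_packing; move: y1.
  by rewrite C0 big1 => [/eqP|H]; rewrite ?inE // eq_sym oner_eq0.
have [H0 H0C] := set0Pn _ Cn0.
(* [x - indicator R H0] is orthogonal to all minimum transversals, so the dimension condition
   applies to it. *)
have xspan : x \in <<[seq indicator R H | H in C]>>%VS.
  rewrite -(subrK (indicator R H0) x).
  apply: memvD; last exact/memv_span/image_f.
  apply: (subvP ((dimension_conditionP Cn0).1 dimC)).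
  apply/orthocomplementP => _ /imageP [B Bm ->].
  by rewrite innerBl xm // inner_indicators card_minb // subrr.
have [c xc] := mem_span_image xspan.
rewrite big_enum_val in xc.
have c1 : \sum_(i < #|C|) c (enum_val i) = 1.
  by rewrite -minb_sum -xc xm.
exists (c \o enum_val); split=> // i.
have [B Bt [k k0]] := facet_coord (c \o enum_val) i.
(* The inequality of [B] becomes [1 <= 1 + c_i * k] with [k] positive, so [c_i] is nonnegative. *)
rewrite -xc c1 => xB; have := xt B Bt.
by rewrite xB lerDl pmulr_lge0.
Qed.

End Polyhedron.

Theorem theorem5p3 (R : realType) (E : finType) (C : {set {set E}})
    (hclutter : clutter C)
    (hcovered : min_transversal_covered C)
    (hblocking : integral_blocking R C)
    (htilde : C = tilde C) :
  (integral_simplex (I_polyhedron (R := R) C) /\ hyperedge_nonseparable C)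
  <->
  (dimension_condition R C /\
   forall H, H \in C ->
     exists2 B, B \in transversals C & facet_transversal C H B).
Proof.
split=> [[simplex nonsep]|[dimC facets]]; last first.
  split; last exact: facets_nonseparable facets.
  exact: facets_integral_simplex dimC facets.
have [n [h [hfree hC hsurj hull]]] :=
  integral_simplex_vertices hcovered htilde hclutter simplex.
split; last first.
  have [y [y0 y1 yb]] := exists_perfect_packing hcovered hblocking htilde.
  move=> H HC; exact: (facet_transversal_exists hcovered hblocking htilde y0 y1 yb hfree).
(* The centre [1_E / bn C] requires [bn C] to be positive, so the empty clutter is treated apart. *)
have [C0|Cn0] := eqVneq C set0; last first.
  exact: (dimension_condition_hull hcovered hblocking htilde Cn0 hC hull).
exact: dimension_condition_set0.
Qed.
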